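(* Assume that there is a real number $\alpha>0$ such that $$\liminf_{x\to\infty}\frac{\#T_{\leq x}(\alpha)}{x}=0.$$ Then there is no perfect Euler brick. In particular, if there is $\alpha>0$ such that $T(\alpha)$ is finite, then there is no perfect Euler brick.
   Context: A perfect Euler brick is a rectangular cuboid whose edges, face diagonals and space diagonal all have (positive) integral lengths. $\mathbb{N}$ is the set of positive integers; $\lfloor x\rfloor$ is the integer part (floor) of $x$. For $X\subseteq\mathbb{N}$, $T(X)$ is the set of all tuples $(k,\ell,m)\in\mathbb{N}^3$ with $k\leq \ell\leq m$ such that all of $k,\ \ell,\ m,\ k+\ell,\ \ell+m,\ m+k,\ k+\ell+m$ belong to $X$. For $\alpha>0$, let $S(\alpha)=\{\lfloor \alpha n^2\rfloor : n\in\mathbb{N},\ n\geq \alpha^{-1/2}\}$ and $T(\alpha)=T(S(\alpha))$. For $\alpha>0$ and $x>1$, let $T_{\leq x}(\alpha)=\{(\lfloor \alpha n_1^2\rfloor,\lfloor\alpha n_2^2\rfloor,\lfloor\alpha n_3^2\rfloor)\in T(\alpha) : n_1,n_2,n_3\in[\alpha^{-1/2},x]\cap\mathbb{N}\}$. *)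

(* Defs.v *)
From HB Require Import structures.
From mathcomp Require Import all_boot all_order all_algebra finmap.
From mathcomp Require Import all_classical all_reals all_analysis.

Set Implicit Arguments.
Unset Strict Implicit.
Unset Printing Implicit Defensive.

Import Order.TTheory GRing.Theory Num.Theory.
Import numFieldNormedType.Exports.

Local Open Scope classical_set_scope.
Local Open Scope ring_scope.

(** The positive integers are the [n : nat] with [(0 < n)%N]. *)

Definition is_posint (R : realType) (x : R) : Prop :=
  exists2 n : nat, (0 < n)%N & x = n%:R.

(** A rectangular cuboid is given by the lengths [a], [b], [c] of its edges. *)
Definition perfect_Euler_brick (R : realType) (a b c : R) : Prop :=
  [/\ is_posint a, is_posint b & is_posint c] /\
  [/\ is_posint (Num.sqrt (a ^+ 2 + b ^+ 2)),
      is_posint (Num.sqrt (b ^+ 2 + c ^+ 2)),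
      is_posint (Num.sqrt (c ^+ 2 + a ^+ 2)) &
      is_posint (Num.sqrt (a ^+ 2 + b ^+ 2 + c ^+ 2))].

Definition T_of (X : set nat) : set (nat * nat * nat) :=
  [set t | let: (k, l, m) := t in
    [/\ (0 < k)%N, (k <= l)%N & (l <= m)%N] /\
    [/\ X k, X l & X m] /\
    [/\ X (k + l)%N, X (l + m)%N, X (m + k)%N & X (k + l + m)%N]].

(** [Num.truncn] is the floor, as a [nat], on nonnegative reals. *)
Definition floor_sq (R : realType) (alpha : R) (n : nat) : nat :=
  Num.truncn (alpha * n%:R ^+ 2).

Definition S_alpha (R : realType) (alpha : R) : set nat :=
  [set floor_sq alpha n |
    n in [set n : nat | (0 < n)%N /\ alpha `^ (- 2^-1) <= n%:R]].

Definition T_alpha (R : realType) (alpha : R) : set (nat * nat * nat) :=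
  T_of (S_alpha alpha).

Definition T_le (R : realType) (alpha x : R) : set (nat * nat * nat) :=
  let I := [set n : nat | (0 < n)%N /\ alpha `^ (- 2^-1) <= n%:R <= x] in
  T_alpha alpha `&`
  [set t | exists n1 n2 n3 : nat, [/\ I n1, I n2 & I n3] /\
    t = (floor_sq alpha n1, floor_sq alpha n2, floor_sq alpha n3)].

(** Hence [fset_set] below computes the true cardinality of [T_le alpha x]. *)
Lemma finite_T_le (R : realType) (alpha x : R) : finite_set (T_le alpha x).
Proof.
pose I := [set n : nat | (0 < n)%N /\ alpha `^ (- 2^-1) <= n%:R <= x].
have finI : finite_set I.
  apply: (sub_finite_set _ (finite_II (Num.truncn x).+1)) => n /= [_ /andP[_ nx]].
  have x0 : 0 <= x by apply: le_trans nx.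
  by rewrite -(ltr_nat R); apply: (le_lt_trans nx); case/andP: (truncn_itv x0).
apply: (sub_finite_set _ (finite_image
  (fun p : nat * nat * nat =>
     (floor_sq alpha p.1.1, floor_sq alpha p.1.2, floor_sq alpha p.2))
  (finite_setX (finite_setX finI finI) finI))).
by move=> t [_ [n1 [n2 [n3 [[I1 I2 I3] ->]]]]]; exists (n1, n2, n3).
Qed.

Definition card_T_le (R : realType) (alpha x : R) : nat :=
  #|` fset_set (T_le alpha x)|%fset.

(* Main.v *)
Require Import Defs.
From mathcomp Require Import all_boot all_order all_algebra finmap.
From mathcomp Require Import all_classical all_reals all_analysis.
From mathcomp Require Import ring lra zify.

Import Order.TTheory GRing.Theory Num.Theory.
Import numFieldNormedType.Exports.

Local Open Scope classical_set_scope.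
Local Open Scope ring_scope.

(** If [a, b, c] are the edges of a perfect brick with space diagonal [g], every
    [n] for which [alpha * n ^ 2] has fractional part below [1 / g ^ 2] yields the
    triple [(floor (alpha (a n)^2), floor (alpha (b n)^2), floor (alpha (c n)^2))]
    of [T_alpha alpha]. Such [n] occur with bounded gaps, which replaces the
    equidistribution of [alpha * n ^ 2] and bounds [# T_le alpha x] below by a
    positive multiple of [x]. *)

(** * Pigeonhole and Diophantine approximation modulo 1 *)

(** [K] comes before [v]: [square_near_int] builds its sequence with a precision that depends on
    [K]. *)
Lemma pigeonhole_mod1 (R : realType) (eta : R) :
  0 < eta -> exists K : nat, forall v : nat -> R,
  exists i j : nat, exists p : int, [/\ (i < j)%N, (j <= K)%N &
    `|v j - v i - p%:~R| < eta].
Proof.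
move=> eta0; pose K := (Num.truncn eta^-1).+1.
have K0 : 0 < K%:R :> R by rewrite ltr0n.
have Keta : K%:R^-1 < eta.
  by rewrite -[ltRHS]invrK ltf_pV2 ?posrE ?invr_gt0// truncnS_gt.
exists K => v.
pose y i := v i - (Num.floor (v i))%:~R.
have y0 i : 0 <= y i by rewrite subr_ge0 floor_le.
have y1 i : y i < 1.
  by have /andP[_] := floor_itv (v i); rewrite rmorphD /= /y; lra.
have b i : (Num.truncn (K%:R * y i) < K)%N.
  by rewrite truncn_lt_nat ?mulr_ge0// -[ltRHS]mulr1 ltr_pM2l.
pose box (i : 'I_K.+1) : 'I_K := Ordinal (b i).
have /injectivePn[i [j neq_ij eq_box]] : ~~ injectiveb box.
  apply/negP => /injectiveP /leq_card; rewrite !card_ord ltnn //.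
wlog lt_ij : i j neq_ij eq_box / (i < j)%N.
  move=> H; have [|ji|/val_inj eq_ij] := ltngtP i j; first exact: H.
    by apply: (H j i) => //; rewrite eq_sym.
  by rewrite eq_ij eqxx in neq_ij.
exists i, j, (Num.floor (v j) - Num.floor (v i)); split => //.
  by rewrite -ltnS.
have -> : v j - v i - (Num.floor (v j) - Num.floor (v i))%:~R = y j - y i.
  by rewrite rmorphB /= /y; ring.
apply: lt_trans Keta.
suff: `|K%:R * (y j - y i)| < 1.
  by rewrite normrM gtr0_norm// mulrC -ltr_pdivlMr// div1r.
have /andP[] := truncn_itv (mulr_ge0 (ltW K0) (y0 i)).
have /andP[] := truncn_itv (mulr_ge0 (ltW K0) (y0 j)).
have /= <- := congr1 val eq_box.
by rewrite ltr_norml -natr1; lra.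
Qed.

Lemma dirichlet_approx (R : realType) (beta eta : R) :
  0 < eta -> exists t : nat, exists p : int,
    (0 < t)%N /\ `|beta * t%:R - p%:~R| < eta.
Proof.
move=> /pigeonhole_mod1[K /(_ (fun n => beta * n%:R))[i [j [p [ij _ H]]]]].
exists (j - i)%N, p; rewrite subn_gt0; split => //.
by rewrite natrB 1?ltnW// mulrBr.
Qed.

(* The prefix sums [s] are chosen so that every cross term [2 * beta * x_k * x_l]
   is almost an integer, hence [beta * (s j - s i) ^ 2] is almost a difference
   of partial sums of [beta * x_k ^ 2], and the pigeonhole principle applies. *)
Lemma square_near_int (R : realType) (beta eta : R) :
  0 < eta -> exists q : nat, exists p : int,
    (0 < q)%N /\ `|beta * q%:R ^+ 2 - p%:~R| < eta.
Proof.
move=> eta0; have eta2 : 0 < eta / 2 by lra.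
have [K HK] := pigeonhole_mod1 R _ eta2.
(* Each step of [key] costs [th], so [K] steps cost at most [eta / 2]; the pigeonhole takes the
   other half. *)
pose th := eta / 2 / K.+1%:R.
have th0 : 0 < th by rewrite divr_gt0.
(* The weight [s%:R] absorbs the factor [s j - s i <= s j] of the cross term. *)
have step (s : nat) : exists x : nat, (0 < x)%N /\
    exists p : int, `|2 * beta * x%:R - p%:~R| * s%:R <= th.
  have [|x [p [x0 H]]] := dirichlet_approx R (2 * beta) (th / s.+1%:R).
    by rewrite divr_gt0.
  exists x; split=> //; exists p.
  rewrite ltr_pdivlMr ?ltr0n// in H; apply: le_trans (ltW H).
  by rewrite ler_wpM2l// ler_nat.
have [x xP] := choice step.
pose s n := iter n (fun s => (s + x s)%N) 0%N.
have s_lt : {homo s : i j / (i < j)%N}.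
  apply: homo_ltn => [|n]; first exact: ltn_trans.
  by rewrite -[ltnLHS]addn0 ltn_add2l; exact: (xP _).1.
pose P n := \sum_(k < n) beta * (x (s k))%:R ^+ 2.
have key i j : (i <= j)%N -> exists p : int,
    `|beta * ((s j)%:R - (s i)%:R) ^+ 2 - (P j - P i) - p%:~R| <= j%:R * th.
  elim: j => [|j IH].
    rewrite leqn0 => /eqP->; exists 0.
    by rewrite !subrr expr0n mulr0 !subr0 normr0 mul0r.
  rewrite leq_eqVlt => /predU1P[->|ltij].
    by exists 0; rewrite !subrr expr0n mulr0 !subr0 normr0 mulr_ge0// ltW.
  have [p Hp] := IH ltij; have [_ [p' Hp']] := xP (s j).
  have les : (s i <= s j)%N.
    by move: ltij; rewrite ltnS leq_eqVlt => /predU1P[->//|/s_lt/ltnW].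
  exists (p + p' * ((s j)%:Z - (s i)%:Z)).
  have -> : beta * ((s j.+1)%:R - (s i)%:R) ^+ 2 - (P j.+1 - P i)
      - (p + p' * ((s j)%:Z - (s i)%:Z))%:~R =
     (beta * ((s j)%:R - (s i)%:R) ^+ 2 - (P j - P i) - p%:~R) +
     (2 * beta * (x (s j))%:R - p'%:~R) * (s j - s i)%:R.
    rewrite natrB// /P big_ord_recr/= intrD intrM intrB natrD -!pmulrn; ring.
  apply: le_trans (ler_normD _ _) _.
  rewrite -[j.+1%:R]natr1 [leRHS]mulrDl mul1r lerD//.
  apply: le_trans Hp'; rewrite normrM ler_wpM2l//.
  by rewrite normr_nat ler_nat leq_subr.
have [i [j [p [ij jK Hp]]]] := HK P.
have [p' Hp'] := key i j (ltnW ij).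
exists (s j - s i)%N, (p + p'); split; first by rewrite subn_gt0 s_lt.
have jth : j%:R * th <= eta / 2.
  by rewrite /th mulrA ler_pdivrMr ?ltr0n// mulrC ler_pM2l// ler_nat leqW.
rewrite natrB 1?ltnW ?s_lt// rmorphD /=.
move: Hp Hp' jth; rewrite ltr_norml ler_norml ltr_norml; lra.
Qed.

(** * Bounded waiting times modulo 1 *)

(** Steps shorter than [L] cannot jump over the window of length [L] that starts at the ceiling of
    [u 0], and [u K] lies beyond this ceiling. *)
Lemma first_passage_mod1 (R : realType) (u : nat -> R) (K : nat) (L : R) :
  0 < L -> u 0%N + 1 <= u K -> (forall i, (i < K)%N -> u i.+1 < u i + L) ->
  exists i : nat, exists m : int, (i <= K)%N /\ m%:~R <= u i < m%:~R + L.
Proof.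
move=> L0 uK du; pose m := Num.ceil (u 0%N).
have /andP[m1 m2] := ceil_itv (u 0%N); rewrite -/m rmorphB /= in m1 m2.
have ex : exists i, m%:~R <= u i by exists K; lra.
case: (ex_minnP ex) => i im imin; exists i, m.
have iK : (i <= K)%N by apply: imin; lra.
split=> //; rewrite im /=.
case: i im imin iK => [|i] im imin iK; first lra.
have := du i iK; have : u i < m%:~R.
  by rewrite ltNge; apply/negP => /imin; rewrite ltnn.
lra.
Qed.

(** Some [t] moves the rotation by a nonzero [th] smaller than [eta]; [K] such moves cover a unit
    length from any [gamma]. *)
Lemma irrational_rotation_bounded_hit (R : realType) (beta eta : R) :
  0 < eta -> (forall (t : nat) (p : int), (0 < t)%N -> beta * t%:R != p%:~R) ->
  exists M : nat, forall gamma : R, exists n : nat, exists m : int,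
    (n <= M)%N /\ `|beta * n%:R + gamma - m%:~R| < eta.
Proof.
move=> eta0 irr; have [t [p [t0 tp]]] := dirichlet_approx R beta eta eta0.
pose th := beta * t%:R - p%:~R.
have th0 : th != 0 by rewrite subr_eq0 irr.
pose K := (Num.truncn `|th|^-1).+1.
have Kth : 1 <= K%:R * `|th|.
  by rewrite -ler_pdivrMr ?normr_gt0// mul1r ltW// truncnS_gt.
exists (t * K)%N => gamma.
(* The sign of [th] makes the orbit increasing and is undone at the end. *)
pose u (i : nat) := Num.sg th * gamma + i%:R * `|th|.
have [|i|i [m [iK /andP[m1 m2]]]] := first_passage_mod1 R u K eta eta0.
- by rewrite /u mul0r addr0; lra.
- by move=> _; rewrite /u -natr1; rewrite -/th in tp; lra.
exists (t * i)%N, (i%:Z * p + sgz th * m); split.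
  by rewrite leq_mul2l iK orbT.
have -> : beta * (t * i)%:R + gamma - (i%:Z * p + sgz th * m)%:~R =
   Num.sg th * (u i - m%:~R).
  have sgsg : Num.sg th * Num.sg th = 1 by rewrite -expr2 sqr_sg th0.
  rewrite /u mulrBr mulrDr mulrA sgsg mul1r mulrCA -numEsg.
  by rewrite natrM rmorphD !rmorphM /= -pmulrn sgrEz /th; ring.
by rewrite normrM normr_sg th0 mul1r ltr_norml; lra.
Qed.

(* Along [n, n + q, n + 2 q, ...] with [2 * alpha * q ^ 2] very close to an
   integer, the increments of [alpha * n ^ 2] modulo 1 are almost constant; the
   rotation by [2 * alpha * q] lets the starting point be chosen, within a bounded
   distance, so that this constant is small and positive. *)
Lemma square_frac_small_bounded_gaps (R : realType) (alpha eps : R) :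
  0 < eps -> exists M : nat, forall N : nat, exists n : nat, exists m : int,
    (N <= n <= N + M)%N /\ m%:~R <= alpha * n%:R ^+ 2 < m%:~R + eps.
Proof.
move=> eps0.
have [[t [p [t0 tp]]]|irr] :=
    pselect (exists t : nat, exists p : int,
      (0 < t)%N /\ 2 * alpha * t%:R = p%:~R).
  (* For every multiple [n] of [2 * t], [alpha * n ^ 2] is an integer. *)
  exists (2 * t)%N => N.
  pose k := (N %/ (2 * t)).+1; exists (k * (2 * t))%N, (p * (2 * t * k ^ 2)%N%:Z).
  have N_eq := divn_eq N (2 * t); have N_lt := ltn_pmod N (_ : 0 < 2 * t)%N.
  split; first by rewrite /k; move: N_lt N_eq; lia.
  have -> : alpha * (k * (2 * t))%:R ^+ 2 = (p * (2 * t * k ^ 2)%N%:Z)%:~R.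
    by rewrite intrM -tp -pmulrn !natrM; ring.
  lra.
(* The increments [D + i * delta] will lie between [eta / 2] and [7 / 2 * eta < eps], so [K] of them
   add up to at least 1. *)
pose eta := eps / 4; have eta0 : 0 < eta by rewrite divr_gt0.
pose K := (Num.truncn (2 / eta)).+1.
have Keta : 1 <= K%:R * (eta / 2).
  by rewrite -ler_pdivrMr ?divr_gt0// mul1r invf_div ltW// truncnS_gt.
have [|q [p [q0 qp]]] := square_near_int R (2 * alpha) (eta / 2 / K%:R).
  by rewrite !divr_gt0.
pose delta := 2 * alpha * q%:R ^+ 2 - p%:~R.
have deltaP i : (i <= K)%N -> `|i%:R * delta| <= eta / 2.
  move=> iK; rewrite ltr_pdivlMr ?ltr0n// mulrC in qp; apply: le_trans (ltW qp).
  by rewrite normrM normr_nat ler_wpM2r// ler_nat.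
have [|M HM] := irrational_rotation_bounded_hit R (2 * alpha * q%:R) eta eta0.
  move=> t p' t0; apply/eqP => tp; apply: irr; exists (q * t)%N, p'.
  by rewrite muln_gt0 q0 t0 natrM mulrA.
exists (M + K * q)%N => N.
(* The term [- 2 * eta] centres the first increment [D] at [2 * eta]. *)
have [n [m [nM nm]]] :=
  HM (2 * alpha * q%:R * N%:R + alpha * q%:R ^+ 2 - 2 * eta).
pose D := 2 * alpha * q%:R * (N + n)%:R + alpha * q%:R ^+ 2 - m%:~R.
have [D1 D2] : eta < D /\ D < 3 * eta.
  by move: nm; rewrite /D natrD ltr_norml; lra.
(* The second differences along the progression are [p + delta]; [w] sums the integer parts
   [m + i * p] of the increments. *)
pose w (i : nat) : int := i%:Z * m + p * 'C(i, 2)%:Z.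
pose u (i : nat) := alpha * (N + n + i * q)%:R ^+ 2 - (w i)%:~R.
have uS i : u i.+1 = u i + (D + i%:R * delta).
  rewrite /u /w /D /delta binS bin1 !(intrD, intrM) -!pmulrn !natrD !natrM.
  rewrite -(natr1 i); ring.
have uge i : (i <= K)%N -> u 0%N + i%:R * (eta / 2) <= u i.
  elim: i => [|i IH] iK; first by rewrite mul0r addr0.
  have := IH (ltnW iK); have := deltaP i (ltnW iK).
  rewrite uS -(natr1 i) ler_norml; lra.
have [||i [z [iK zu]]] := first_passage_mod1 R u K eps eps0.
- by have := uge K (leqnn K); lra.
- move=> i iK; rewrite uS ltrD2l; have := deltaP i (ltnW iK).
  by rewrite ler_norml /eta in D1 D2 eta0 *; lra.
exists (N + n + i * q)%N, (z + w i); split.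
  have := leq_mul2r q i K; rewrite iK orbT; move: nM; lia.
by move: zu; rewrite /u intrD; lra.
Qed.

(** * From a brick to triples *)

Lemma floor_sq_mul (R : realType) (alpha : R) (a n k : nat) :
  k%:R <= alpha * n%:R ^+ 2 -> a%:R ^+ 2 * (alpha * n%:R ^+ 2 - k%:R) < 1 ->
  floor_sq alpha (a * n) = (a ^ 2 * k)%N.
Proof.
move=> k1 k2; apply: truncn_def.
have -> : alpha * (a * n)%:R ^+ 2 =
    a%:R ^+ 2 * (alpha * n%:R ^+ 2 - k%:R) + (a ^ 2 * k)%:R :> R.
  by rewrite !natrM; ring.
rewrite -[X in _ < X]natr1 lerDr mulr_ge0 ?sqr_ge0 ?subr_ge0//=.
by rewrite addrC ltrD2l.
Qed.

Definition integer_brick (a b c d e f g : nat) : Prop :=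
  [/\ (a ^ 2 + b ^ 2 = d ^ 2)%N, (b ^ 2 + c ^ 2 = e ^ 2)%N,
      (c ^ 2 + a ^ 2 = f ^ 2)%N & (a ^ 2 + b ^ 2 + c ^ 2 = g ^ 2)%N].

(** Permuting the edges only permutes the face diagonals; the order is what [T_of] asks for. *)
Lemma integer_brick_sorted (a b c d e f g : nat) :
  (0 < a)%N -> (0 < b)%N -> (0 < c)%N -> integer_brick a b c d e f g ->
  exists a b c d e f g : nat,
    [/\ (0 < a)%N, (a <= b)%N & (b <= c)%N] /\ integer_brick a b c d e f g.
Proof.
wlog ab : a b c d e f g / (a <= b)%N.
  move=> H a0 b0 c0 [d_eq e_eq f_eq g_eq].
  have [ab|/ltnW ba] := leqP a b; first exact: (H a b c d e f g).
  apply: (H b a c d f e g) => //.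
  by split; lia.
move=> a0 b0 c0 brick; have [d_eq e_eq f_eq g_eq] := brick.
have [bc|/ltnW cb] := leqP b c; first by exists a, b, c, d, e, f, g.
have [ac|/ltnW ca] := leqP a c.
  by exists a, c, b, f, e, d, g; do ?split; lia.
by exists c, a, b, f, d, e, g; do ?split; lia.
Qed.

Lemma perfect_Euler_brick_integer (R : realType) (a b c : R) :
  perfect_Euler_brick a b c -> exists a b c d e f g : nat,
    [/\ (0 < a)%N, (0 < b)%N & (0 < c)%N] /\ integer_brick a b c d e f g.
Proof.
have sqrt_nat (m n : nat) : Num.sqrt m%:R = n%:R :> R -> m = (n ^ 2)%N.
  by move=> mn; apply/eqP; rewrite -(eqr_nat R) natrX -mn sqr_sqrtr.
move=> [[[m m0 ->] [n n0 ->] [k k0 ->]]].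
rewrite -!natrX -!natrD => -[[d _ /sqrt_nat ?] [e _ /sqrt_nat ?]
  [f _ /sqrt_nat ?] [g _ /sqrt_nat ?]].
by exists m, n, k, d, e, f, g.
Qed.

(* If the fractional part of [alpha * n ^ 2] is below [1 / g ^ 2], multiplying by
   any of the seven squares of the brick commutes with taking the floor. *)
Lemma T_le_brick (R : realType) (alpha x : R) (a b c d e f g n k : nat) :
  (0 < a)%N -> (a <= b)%N -> (b <= c)%N -> integer_brick a b c d e f g ->
  (0 < n)%N -> (0 < k)%N -> alpha `^ (- 2^-1) <= n%:R -> (c * n)%:R <= x ->
  k%:R <= alpha * n%:R ^+ 2 < k%:R + (g%:R ^+ 2)^-1 ->
  T_le alpha x (a ^ 2 * k, b ^ 2 * k, c ^ 2 * k)%N.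
Proof.
move=> a0 ab bc [d_eq e_eq f_eq g_eq] n0 k0 n_ge cn_le /andP[k1 k2].
have g0 : (0 < g ^ 2)%N by rewrite -g_eq !addn_gt0 expn_gt0 a0.
(* [g] is the longest of the seven lengths, so its bound serves them all. *)
have fl z : (z ^ 2 <= g ^ 2)%N -> floor_sq alpha (z * n) = (z ^ 2 * k)%N.
  move=> zg; apply: floor_sq_mul => //.
  apply: (@le_lt_trans _ _ (g%:R ^+ 2 * (alpha * n%:R ^+ 2 - k%:R))).
    by rewrite ler_wpM2r ?subr_ge0// -!natrX ler_nat.
  by rewrite mulrC -ltr_pdivlMr ?div1r ?ltrBlDl// -natrX ltr0n.
have mem z : (0 < z ^ 2)%N -> (z ^ 2 <= g ^ 2)%N ->
    S_alpha alpha (z ^ 2 * k)%N.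
  rewrite expn_gt0 orbF => z0 zg; exists (z * n)%N; last exact: fl.
  split; first by rewrite muln_gt0 z0.
  by apply: le_trans n_ge _; rewrite ler_nat leq_pmull.
have a2 : (0 < a ^ 2)%N by rewrite expn_gt0 a0.
have ab2 : (a ^ 2 <= b ^ 2)%N by rewrite leq_sqr.
have bc2 : (b ^ 2 <= c ^ 2)%N by rewrite leq_sqr.
split.
  split; first by rewrite muln_gt0 a2 k0 !leq_mul2r ab2 bc2 !orbT.
  (* The brick equations turn the four sums into squares times [k]. *)
  rewrite -!mulnDl g_eq d_eq e_eq f_eq.
  by split; split; apply: mem; rewrite // -?d_eq -?e_eq -?f_eq -?g_eq; lia.
exists (a * n)%N, (b * n)%N, (c * n)%N; split; last first.
  by rewrite !fl// -g_eq; lia.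
have I z : (0 < z)%N -> (z <= c)%N ->
    (0 < z * n)%N /\ alpha `^ (- 2^-1) <= (z * n)%:R <= x.
  move=> z0 zc; rewrite muln_gt0 z0 n0; split => //.
  rewrite (le_trans n_ge) ?ler_nat ?leq_pmull//=.
  by apply: le_trans cn_le; rewrite ler_nat leq_mul2r zc orbT.
by split; apply: I => //; lia.
Qed.

(** * Linear growth of the count *)

(** Each block of [M.+1] integers from [N0] on contains a suitable [n], and distinct blocks give
    distinct triples. The factor [c] in [C] and [L] accounts for the largest index [c * n]. *)
Lemma card_T_le_brick (R : realType) (alpha : R) (a b c d e f g : nat) :
  (0 < a)%N -> (a <= b)%N -> (b <= c)%N -> integer_brick a b c d e f g ->
  0 < alpha ->
  exists C L : nat, (0 < L)%N /\ forall (J : nat) (x : R),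
    (C + J * L)%:R <= x -> (J <= card_T_le alpha x)%N.
Proof.
move=> a0 ab bc brick alpha0; have [_ _ _ g_eq] := brick.
have g0 : (0 < g ^ 2)%N by rewrite -g_eq !addn_gt0 expn_gt0 a0.
have [|M HM] := square_frac_small_bounded_gaps R alpha (g%:R ^+ 2)^-1.
  by rewrite invr_gt0 -natrX ltr0n.
(* The summand [alpha^-1] forces [alpha * n >= 1], which makes [k] positive and strictly
   increasing. *)
pose N0 := (Num.truncn (alpha `^ (- 2^-1) + alpha^-1)).+1.
have pow0 : 0 <= alpha `^ (- 2^-1) by rewrite powR_ge0.
have inv0 : 0 < alpha^-1 by rewrite invr_gt0.
have N0P : alpha `^ (- 2^-1) + alpha^-1 < N0%:R by exact: truncnS_gt.
have [n nP] := choice (fun j => HM (N0 + j * M.+1)%N).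
have n_ge j : (N0 <= n j)%N.
  by have [m [/andP[+ _] _]] := nP j; apply: leq_trans; rewrite leq_addr.
have an_ge j : 1 <= alpha * (n j)%:R.
  have : N0%:R <= (n j)%:R :> R by rewrite ler_nat.
  rewrite -ler_pdivrMl// mulr1; lra.
pose k j := Num.truncn (alpha * (n j)%:R ^+ 2).
have k_ge j : 1 <= alpha * (n j)%:R ^+ 2.
  rewrite expr2 mulrA (le_trans (an_ge j))// ler_peMr//; last first.
    by rewrite ler1n (leq_trans _ (n_ge j)).
  by apply: le_trans (an_ge j).
have kP j : (k j)%:R <= alpha * (n j)%:R ^+ 2 < (k j)%:R + (g%:R ^+ 2)^-1.
  have [m [_ /andP[m1 m2]]] := nP j.
  have /andP[k1 k2] := truncn_itv (le_trans ler01 (k_ge j)).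
  (* The integer [m] is at most the floor [k j], so its upper bound carries over. *)
  rewrite /k k1/=; apply: lt_le_trans m2 _; rewrite lerD2r.
  have : m%:~R < (Num.truncn (alpha * (n j)%:R ^+ 2)).+1%:R :> R.
    exact: le_lt_trans m1 k2.
  by rewrite !pmulrn ltr_int ler_int; lia.
have k_lt : {homo k : i j / (i < j)%N}.
  apply: homo_ltn => [|j]; first exact: ltn_trans.
  have [m [/andP[_ nj] _]] := nP j; have [m' [/andP[nj' _] _]] := nP j.+1.
  have n_lt : (n j < n j.+1)%N by move: nj nj'; lia.
  rewrite truncn_gt_nat -natr1.
  have /andP[k1 _] := kP j; have an := an_ge j.
  apply: (@le_trans _ _ (alpha * (n j)%:R ^+ 2 + alpha * (n j)%:R)); first lra.
  apply: (@le_trans _ _ (alpha * (n j).+1%:R ^+ 2)); last first.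
    by rewrite ler_pM2l// -!natrX ler_nat leq_sqr.
  by rewrite -natr1; nra.
have k_inj : injective k.
  by move=> i j kij; have [/k_lt|/k_lt|//] := ltngtP i j; rewrite kij ltnn.
exists (c * N0)%N, (c * M.+1)%N; split; first by rewrite muln_gt0/=; lia.
move=> J x x_ge.
pose t j := (a ^ 2 * k j, b ^ 2 * k j, c ^ 2 * k j)%N.
have t_inj : injective t.
  move=> i j [/eqP + _ _]; rewrite eqn_mul2l expn_eq0 eqn0Ngt a0/=.
  by move/eqP/k_inj.
rewrite -(size_iota 0 J) -(size_map t); apply: uniq_leq_size.
  by rewrite map_inj_uniq ?iota_uniq.
move=> _ /mapP[j + ->]; rewrite mem_iota add0n => /andP[_ jJ].
rewrite in_fset_set ?inE; last exact: finite_T_le.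
have n0 : (0 < n j)%N by apply: leq_trans (n_ge j).
apply: (T_le_brick _ _ _ _ _ _ _ _ _ _ (n j) _ _ _ _ brick) => //.
- by rewrite truncn_gt0.
- have : N0%:R <= (n j)%:R :> R by rewrite ler_nat.
  lra.
- apply: le_trans x_ge; rewrite ler_nat mulnCA -mulnDr leq_mul2l.
  have [m [/andP[_ nj] _]] := nP j; apply/orP; right; nia.
Qed.


Lemma liminf_card_T_le_gt0 (R : realType) (alpha : R) (C L : nat) : (0 < L)%N ->
  (forall (J : nat) (x : R), (C + J * L)%:R <= x -> (J <= card_T_le alpha x)%N) ->
  (0 < limf_einf (fun x : R => ((card_T_le alpha x)%:R / x)%:E)
    (pinfty_nbhs R))%E.
Proof.
move=> L0 HJ; have L0' : 0 < L%:R :> R by rewrite ltr0n.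
apply: (@lt_le_trans _ _ (2 * L%:R)^-1%:E).
  by rewrite lte_fin invr_gt0 mulr_gt0.
rewrite limf_einfE; apply: le_trans (ereal_sup_ubound _); last first.
  (* Beyond this threshold [(x - C) / L - 1] exceeds [x / (2 * L)]. *)
  exists [set x | 2 * (C + L)%:R < x] => //.
  by exists (2 * (C + L)%:R); rewrite num_real.
apply: le_ereal_inf_tmp => _ [x /= xC <-]; rewrite natrD in xC.
have C0 : 0 <= C%:R :> R by [].
have x0 : 0 < x by lra.
have xC0 : 0 <= (x - C%:R) / L%:R by rewrite divr_ge0 ?ltW//; lra.
rewrite lee_fin ler_pdivlMr//.
apply: (@le_trans _ _ (Num.truncn ((x - C%:R) / L%:R))%:R); last first.
  rewrite ler_nat; apply: HJ; rewrite natrD natrM -lerBrDl -ler_pdivlMr//.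
  by rewrite truncn_le.
have := truncnS_gt ((x - C%:R) / L%:R); rewrite -natr1 ltr_pdivrMr// => tx.
by rewrite ler_pdivrMl ?mulr_gt0//; nra.
Qed.

Theorem theorem1p6 (R : realType) :
  ((exists alpha : R, 0 < alpha /\
      limf_einf (fun x : R => ((card_T_le alpha x)%:R / x)%:E) (pinfty_nbhs R)
        = 0%E) ->
    ~ exists a b c : R, perfect_Euler_brick a b c) /\
  ((exists alpha : R, 0 < alpha /\ finite_set (T_alpha alpha)) ->
    ~ exists a b c : R, perfect_Euler_brick a b c).
Proof.
split=> -[alpha [alpha0 H]] [? [? [? /perfect_Euler_brick_integer
    [? [? [? [? [? [? [? [[? ? ?] /integer_brick_sorted]]]]]]]]]]];
  case=> // a [b [c [d [e [f [g [[a0 ab bc] brick]]]]]]];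
  have [C [L [L0 HJ]]] := card_T_le_brick _ _ _ _ _ _ _ _ _ a0 ab bc brick alpha0.
  by have := liminf_card_T_le_gt0 _ _ _ _ L0 HJ; rewrite H ltxx.
(* A suitable [x] would give [T_le alpha x] more elements than the set [T_alpha alpha] containing
   it. *)
have := HJ #|` fset_set (T_alpha alpha)|%fset.+1 _ (lexx _).
rewrite ltnNge => /negP; apply; apply: fsubset_leq_card.
by rewrite -fset_set_sub//; [exact: subIsetl|exact: finite_T_le].
Qed.
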